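(* There exists a universal constant $C_2>0$ such that the following holds. Consider the Gaussian linear regression model $\mathbf{y}=X\boldsymbol{\beta}+\boldsymbol{\epsilon}$ with $X\in\mathbb{R}^{n\times p}$, $r=\mathrm{rank}(X)$, any $r$ columns of $X$ linearly independent, $\boldsymbol{\beta}\in\mathbb{R}^p$ and $\boldsymbol{\epsilon}\sim N(\mathbf{0},\sigma^2 I_n)$ with known $\sigma^2>0$, and let $1\le p_0\le r$. Then $$\inf_{\hat{\mathbf{y}}}\sup_{\boldsymbol{\beta}:\|\boldsymbol{\beta}\|_0\le p_0}E\|\hat{\mathbf{y}}-X\boldsymbol{\beta}\|^2\ \ge\ \begin{cases} C_2\,\sigma^2\,\tau[2p_0]\;p_0(\ln(p/p_0)+1), & 1\le p_0\le r/2,\\ C_2\,\sigma^2\,\tau[p_0]\;r, & r/2\le p_0\le r,\end{cases}$$ where the infimum is taken over all estimates $\hat{\mathbf{y}}$ (measurable functions of $\mathbf{y}$) of the mean vector $X\boldsymbol{\beta}$.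
   Context: $\|\boldsymbol{\beta}\|_0$ is the number of nonzero entries of $\boldsymbol{\beta}$, $\|\cdot\|$ is the Euclidean norm and $E$ is the expectation with respect to $\boldsymbol{\epsilon}$. For $k=1,\dots,r$ the $k$-sparse minimal and maximal eigenvalues of the design are $$\phi_{min}[k]=\min_{\boldsymbol{\beta}:1\le\|\boldsymbol{\beta}\|_0\le k}\frac{\|X\boldsymbol{\beta}\|^2}{\|\boldsymbol{\beta}\|^2},\qquad \phi_{max}[k]=\max_{\boldsymbol{\beta}:1\le\|\boldsymbol{\beta}\|_0\le k}\frac{\|X\boldsymbol{\beta}\|^2}{\|\boldsymbol{\beta}\|^2},$$ and $\tau[k]=\phi_{min}[k]/\phi_{max}[k]$ for $k=1,\dots,r$, with $\tau[k]=\tau[r]$ for all $k>r$. *)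

(* Defs.v *)
From HB Require Import structures.
From mathcomp Require Import all_boot all_order all_algebra.
From mathcomp Require Import all_classical all_reals all_analysis.
Set Implicit Arguments.
Unset Strict Implicit.
Unset Printing Implicit Defensive.
Import Order.TTheory GRing.Theory Num.Theory.
Import numFieldNormedType.Exports.
Local Open Scope classical_set_scope.
Local Open Scope ring_scope.

(* Vectors that take part in linear algebra are columns ['cV[R]_n]; observations
   are [n.-tuple R], the type on which the library puts the product
   sigma-algebra, i.e. the Borel sigma-algebra of R^n. *)

(* The library norm on ['cV[R]_n] is the max norm, hence this definition. *)
Definition norm2 (R : realType) (n : nat) (v : 'cV[R]_n) : R :=
  Num.sqrt (\sum_(i < n) v i 0 ^+ 2).

Definition norm0 (R : realType) (p : nat) (b : 'cV[R]_p) : nat :=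
  #|[pred i | b i 0 != 0]|.

Section sparse_eigenvalues.
Variables (R : realType) (n p : nat) (X : 'M[R]_(n, p)).

Definition sparse_quotients (k : nat) : set R :=
  [set norm2 (X *m b) ^+ 2 / norm2 b ^+ 2 |
    b in [set b : 'cV[R]_p | (1 <= norm0 b <= k)%N]].

(* For k >= 1 and p >= 1 the extrema below are attained (a continuous function
   on a finite union of unit spheres), so [inf] and [sup] are the minimum and
   the maximum. *)
Definition phi_min (k : nat) : R := inf (sparse_quotients k).

Definition phi_max (k : nat) : R := sup (sparse_quotients k).

(* [minn] implements the convention that tau is constant beyond the rank. *)
Definition tau (k : nat) : R :=
  phi_min (minn k (\rank X)) / phi_max (minn k (\rank X)).

Definition any_rank_columns_independent : Prop :=
  forall f : 'I_(\rank X) -> 'I_p, injective f -> row_free (colsub f X)^T.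

End sparse_eigenvalues.

Section gaussian_noise.
Variables (R : realType) (d : measure_display) (Omega : measurableType d).
Variables (P : probability Omega R) (n : nat) (eps : 'I_n -> {RV P >-> R}).

Definition mutually_independent : Prop :=
  forall (J : {set 'I_n}) (A : 'I_n -> set R),
    (forall i, measurable (A i)) ->
    P (\bigcap_(i in [set` J]) eps i @^-1` A i) =
    (\prod_(i in J) P (eps i @^-1` A i))%E.

(* The law N(0, sigma^2 I_n) for the vector of the [eps i]; the second
   parameter of [normal_prob] is the standard deviation. *)
Definition gaussian_noise (sigma : R) : Prop :=
  (forall (i : 'I_n) (A : set R), measurable A ->
     distribution P (eps i) A = normal_prob 0 sigma A) /\
  mutually_independent.

Variables (p : nat) (X : 'M[R]_(n, p)).

Definition response (b : 'cV[R]_p) (w : Omega) : n.-tuple R :=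
  [tuple (X *m b) i 0 + eps i w | i < n].

(* The value is an extended real: a measurable estimator may have infinite
   quadratic risk. *)
Definition risk (yhat : n.-tuple R -> n.-tuple R) (b : 'cV[R]_p) : \bar R :=
  ('E_P[fun w =>
     (norm2 (\col_i tnth (yhat (response b w)) i - X *m b) ^+ 2)%R])%E.

Definition minimax_risk (p0 : nat) : \bar R :=
  ereal_inf [set ereal_sup [set risk yhat b |
                             b in [set b : 'cV[R]_p | (norm0 b <= p0)%N]] |
    yhat in [set yhat : n.-tuple R -> n.-tuple R |
              measurable_fun [set: n.-tuple R] yhat]].

End gaussian_noise.

(* Main.v *)
(** Assouad's method with [M] options per block. Fix [k] disjoint blocks of
    columns and let the unknown mean be a sum of one vector per block, chosen
    uniformly among [M] of squared length at most [sigma^2 (ln M) / 2].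
    By the Cameron-Martin formula the Bayes risk is the integral, against the
    pure noise, of a likelihood-weighted sum of squared errors. Pointwise, an
    estimate can be close to the nearest candidate mean only, so the sum is
    bounded below by the weight of the means that differ from it in some block;
    comparing each likelihood with that of the mean whose block is set to zero
    (a chi-square argument) bounds this weight by an explicit combination of
    likelihoods, each of integral 1. Thus every block is misidentified with
    probability bounded below, and an error in a block costs at least the
    sparse minimal eigenvalue times the squared amplitude. Blocks of
    [p %/ p0] columns give the sparse regime, blocks made of one column with
    coefficients 0 and 1 the dense one. *)
Require Import Defs.
From HB Require Import structures.
From mathcomp Require Import all_boot all_order all_algebra.
From mathcomp Require Import all_classical all_reals all_analysis.
From mathcomp Require Import measurable_realfun ring lra.
Import Order.TTheory GRing.Theory Num.Theory.
Import numFieldNormedType.Exports.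
Local Open Scope classical_set_scope.
Local Open Scope ring_scope.

Set Implicit Arguments.
Unset Strict Implicit.
Unset Printing Implicit Defensive.

(** * Change of measure *)

Section density.
Local Open Scope ereal_scope.
Context d (T : measurableType d) (R : realType).
Variables (m : {measure set T -> \bar R}) (l : T -> R).
Hypotheses (ml : measurable_fun [set: T] l) (l_ge0 : forall x, (0 <= l x)%R).

(** Countable additivity is that of the integral of a nonnegative function over disjoint sets. The
    existential form provides a bundled measure. *)
Lemma density_measure :
  exists nu : {measure set T -> \bar R},
    forall A, nu A = \int[m]_(x in A) (l x)%:E.
Proof.
pose nu A := \int[m]_(x in A) (l x)%:E.
have nu0 : nu set0 = 0 by rewrite /nu integral_set0.
have nu_ge0 A : 0 <= nu A.
  by rewrite /nu integral_ge0// => x _; rewrite lee_fin.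
have nu_sa : semi_sigma_additive nu.
  move=> F mF tF mUF; rewrite /nu ge0_integral_bigcup//; last 2 first.
  - by apply: measurable_funTS; exact/measurable_EFinP.
  - by move=> x _; rewrite lee_fin.
  by apply: is_cvg_ereal_nneg_natsum_cond => n _ _; exact: nu_ge0.
pose mix := isMeasure.Build _ _ _ nu nu0 nu_ge0 nu_sa.
pose numu : {measure set T -> \bar R} := HB.pack nu mix.
by exists numu.
Qed.

Import HBNNSimple.

(** The hypothesis is the case of indicators; linearity gives simple functions and monotone
    convergence the rest. With [nu] arbitrary, it can be a normal law, a tilted law or the
    restriction of [P] to an event. *)
Lemma ge0_integral_density (nu : {measure set T -> \bar R}) (f : T -> \bar R) :
  (forall A, measurable A -> nu A = \int[m]_(x in A) (l x)%:E) ->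
  measurable_fun [set: T] f -> (forall x, 0 <= f x) ->
  \int[nu]_x f x = \int[m]_x (f x * (l x)%:E).
Proof.
move=> nuE mf f0; pose h := nnsfun_approx measurableT mf.
have mlE : measurable_fun [set: T] (EFin \o l) by exact/measurable_EFinP.
have hE n : \int[nu]_x (h n x)%:E = \int[m]_x ((h n x)%:E * (l x)%:E).
  under eq_integral do rewrite fimfunE -fsumEFin//.
  rewrite [LHS]ge0_integral_fsum//; last 2 first.
  - by move=> r; exact/measurable_EFinP/measurable_funM.
  - by move=> r x _; rewrite EFinM nnfun_muleindic_ge0.
  under [RHS]eq_integral.
    move=> x _; rewrite fimfunE -fsumEFin// ge0_mule_fsuml; last first.
      by move=> r; rewrite EFinM nnfun_muleindic_ge0.
    over.
  rewrite [RHS]ge0_integral_fsum//; last 2 first.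
  - move=> r; apply: emeasurable_funM => //.
    by exact/measurable_EFinP/measurable_funM.
  - move=> r x _; apply: mule_ge0; rewrite ?lee_fin//.
    by rewrite -lee_fin EFinM nnfun_muleindic_ge0.
  apply: eq_fsbigr => r rh.
  have mr : measurable (h n @^-1` [set r]) by [].
  have r0 : (0 <= r)%R by move: rh; rewrite inE => -[x _ <-].
  rewrite integralZl_indic_nnsfun// integral_indic// setIT nuE//.
  under [RHS]eq_integral do rewrite EFinM -muleA.
  rewrite ge0_integralZl_EFin//; last 2 first.
  - by move=> x _; rewrite mule_ge0 ?lee_fin.
  - by apply: emeasurable_funM => //; exact/measurable_EFinP/measurable_indic.
  congr (_ * _); rewrite [LHS]integral_mkcond; apply: eq_integral => x _.
  by rewrite restrict_EFin patch_indic/= -EFinM mulrC.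
transitivity (limn (fun n => \int[nu]_x (h n x)%:E)).
  rewrite -monotone_convergence//=.
  - apply: eq_integral => x _; apply/esym/cvg_lim => //=.
    exact: cvg_nnsfun_approx.
  - by move=> n; exact/measurable_EFinP.
  - by move=> n x _; rewrite lee_fin.
  - by move=> x _ a b ab; rewrite lee_fin//; exact/lefP/nd_nnsfun_approx.
under eq_fun do rewrite hE.
rewrite -monotone_convergence//=.
- apply: eq_integral => x _; apply/cvg_lim => //=.
  by apply: cvgeZr => //; exact: cvg_nnsfun_approx.
- by move=> n; apply: emeasurable_funM => //; exact/measurable_EFinP.
- by move=> n x _; rewrite mule_ge0 ?lee_fin.
- move=> x _ a b ab; rewrite lee_wpmul2r ?lee_fin//.
  exact/lefP/nd_nnsfun_approx.
Qed.

End density.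

(** * Translation of the normal law on the line *)

Section gaussian_shift.
Local Open Scope ereal_scope.
Context (R : realType).
Notation mu := (@lebesgue_measure R).

Lemma lebesgue_measure_shift (t : R) (A : set R) : measurable A ->
  pushforward mu (+%R^~ t : _ -> measurableTypeR R) A = mu A.
Proof.
move=> mA.
have mt : measurable_fun [set: measurableTypeR R] (+%R^~ t).
  exact: measurable_funD.
apply/esym/lebesgue_measure_unique => //= _ [[a b]] _ <-.
rewrite /pushforward /=.
have -> : +%R^~ t @^-1` `]a, b]%classic = `](a - t)%R, (b - t)%R]%classic.
  by apply/seteqP; split => x /=; rewrite !in_itv/= ltrBlDr lerBrDr.
rewrite !lebesgue_measure_itv/= !lte_fin ltrD2r; case: ifP => // _.
by rewrite -!EFinD; congr (_%:E); ring.
Qed.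

(** One-dimensional Cameron-Martin formula: the weight is the ratio of the densities of N(t,
    sigma^2) and N(0, sigma^2), so against Lebesgue measure it turns the centred density into its
    translate. *)
Lemma normal_prob_shift (sigma t : R) (A : set R) : sigma != 0%R ->
  measurable A ->
  normal_prob 0 sigma (+%R^~ t @^-1` A) =
  \int[normal_prob 0 sigma]_(x in A)
     (expR ((t * x - t ^+ 2 / 2) / sigma ^+ 2))%:E.
Proof.
move=> s0 mA; rewrite [RHS]integral_mkcond.
rewrite (@ge0_integral_density _ _ _ mu (normal_pdf 0 sigma)) //; last 4 first.
- exact: measurable_normal_pdf.
- by move=> x; exact: normal_pdf_ge0.
- apply/(measurable_restrictT _ mA); apply/measurable_EFinP.
  apply: measurable_funTS; apply: measurableT_comp => //.
  apply: measurable_funM => //; apply: measurable_funB => //.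
- by move=> x; apply: erestrict_ge0 => y _; rewrite lee_fin expR_ge0.
transitivity (\int[mu]_(x in A) (normal_pdf 0 sigma (x - t))%:E); last first.
  rewrite [LHS]integral_mkcond; apply: eq_integral => x _.
  rewrite /patch; case: ifP => _; last by rewrite mul0e.
  rewrite -EFinM; congr (_%:E).
  rewrite !normal_pdfE// /normal_fun mulrCA; congr (_ * _)%R.
  by rewrite -expRD; congr expR; rewrite !subr0; field.
have mt : measurable_fun [set: measurableTypeR R] (+%R^~ t).
  exact: measurable_funD.
rewrite [RHS](eq_measure_integral
  (pushforward mu (+%R^~ t : _ -> measurableTypeR R))) /=; last first.
  by move=> B mB _; exact/esym/lebesgue_measure_shift.
rewrite ge0_integral_pushforward//.
- by apply: eq_integral => x _ /=; rewrite addrK.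
- apply: measurable_funTS; apply/measurable_EFinP.
  apply: (measurableT_comp (measurable_normal_pdf _ _)).
  exact: measurable_funB.
- by move=> x _; rewrite lee_fin normal_pdf_ge0.
Qed.

End gaussian_shift.

(** * Cameron-Martin formula for one coordinate of the noise *)

Section cameron_martin.
Local Open Scope ereal_scope.
Context (R : realType) (d : measure_display) (Omega : measurableType d).
Variables (P : probability Omega R) (n : nat) (eps : 'I_n -> {RV P >-> R}).

(** [response] is the case where [theta] is [X *m b]; a free [theta] allows shifting one coordinate
    at a time. *)
Definition shifted_noise (theta : 'I_n -> R) (w : Omega) : n.-tuple R :=
  [tuple (theta i + eps i w)%R | i < n].

Lemma measurable_shifted_noise (theta : 'I_n -> R) :
  measurable_fun [set: Omega] (shifted_noise theta).
Proof.
apply/measurable_fun_tnthP => i.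
rewrite (_ : _ \o _ = fun w => (theta i + eps i w)%R); last first.
  by apply/funext => w /=; rewrite tnth_mktuple.
exact: measurable_funD.
Qed.

Definition rectangles : set (set (n.-tuple R)) :=
  [set \bigcap_(i in [set: 'I_n]) ((@tnth n R)^~ i @^-1` A i) |
    A in [set A : 'I_n -> set R | forall i, measurable (A i)]].

(** A generator of the product sigma-algebra constrains one coordinate, hence is a rectangle whose
    other sides are the whole line; conversely a rectangle is a finite intersection of
    generators. *)
Lemma measurable_rectangles :
  (measurable : set (set (n.-tuple R))) = <<s rectangles >>.
Proof.
apply/seteqP; split.
  apply: smallest_sub; first exact: smallest_sigma_algebra.
  rewrite -bigcup_seq => B /= [i _ [A mA <-]].
  apply: sub_sigma_algebra.
  exists (fun j => if j == i then A else setT).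
    by move=> j; case: ifP.
  apply/seteqP; split => x /=.
    by move=> /(_ i I); rewrite eqxx => ?; split.
  by move=> [_ Ax] j _; rewrite /preimage/=; case: eqP => [->|].
apply: smallest_sub; first exact: sigma_algebra_measurable.
move=> _ [A mA <-]; apply: fin_bigcap_measurable => // i _.
by rewrite -[X in measurable X]setTI; exact: measurable_tnth.
Qed.

Lemma setI_closed_rectangles : setI_closed rectangles.
Proof.
move=> _ _ [A mA <-] [B mB <-]; exists (fun i => A i `&` B i).
  by move=> i; exact: measurableI.
by rewrite -bigcapI; apply: eq_bigcapr => i _; rewrite preimage_setI.
Qed.

(** Rectangles form a generating family stable under intersection; the whole space is itself a
    rectangle and serves as the exhausting sequence. *)
Lemma eq_measure_rectangles (m1 m2 : {measure set (n.-tuple R) -> \bar R}) :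
  m1 setT < +oo -> (forall B, rectangles B -> m1 B = m2 B) ->
  forall B, measurable B -> m1 B = m2 B.
Proof.
move=> m1oo m12 B mB.
apply: (measure_unique rectangles (fun=> setT) measurable_rectangles) => //.
- exact: setI_closed_rectangles.
- by move=> _; exists (fun=> setT) => //; apply: bigcapT.
- by rewrite bigcup_const.
Qed.

Variable sigma : R.
Hypotheses (sigma0 : sigma != 0%R) (Heps : gaussian_noise eps sigma).

(** By independence, restricting [P] to the event [B] on the other coordinates multiplies the law of
    [eps i] by [P B]; a change of variables concludes. *)
Lemma independent_integral (i : 'I_n) (A : 'I_n -> set R) (f : R -> R) :
  (forall j, measurable (A j)) -> measurable_fun [set: R] f ->
  (forall x, 0 <= f x)%R ->
  \int[P]_(w in \bigcap_(j in [set: 'I_n]) (eps j @^-1` A j)) (f (eps i w))%:E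
  = (\prod_(j < n | j != i) P (eps j @^-1` A j)) *
    \int[normal_prob 0 sigma]_(x in A i) (f x)%:E.
Proof.
move=> mA mf f0; have [law indep] := Heps.
have mepsA j C : measurable C -> measurable (eps j @^-1` C).
  by move=> mC; rewrite -[X in measurable X]setTI; exact: measurable_funPT.
pose B := \bigcap_(j in [set` [set~ i]%SET]) (eps j @^-1` A j).
have mB : measurable B by apply: fin_bigcap_measurable => // j _; exact: mepsA.
have PB : P B = \prod_(j < n | j != i) P (eps j @^-1` A j).
  rewrite (indep [set~ i]%SET A mA).
  by apply: eq_bigl => j; rewrite !inE.
have indepB C : measurable C -> P (eps i @^-1` C `&` B) =
    P B * normal_prob 0 sigma C.
  move=> mC.
  (* Independence is used over all indices, with side [i] of the rectangle replaced by [C]. *)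
  pose A' j := if j == i then C else A j.
  have mA' j : measurable (A' j) by rewrite /A'; case: ifP.
  have := indep [set: 'I_n]%SET A' mA'.
  rewrite (bigD1 i) ?inE//= {2}/A' eqxx -(law i C mC) => h.
  rewrite muleC PB; transitivity
    (P (\bigcap_(i0 in [set` [set: 'I_n]%SET]) eps i0 @^-1` A' i0)).
    congr (P _); apply/seteqP; split => w /=.
      move=> [Cw Bw] j _; rewrite /A' /preimage/=; case: eqP => [->//|/eqP ji].
      by apply: Bw; rewrite /= !inE.
    move=> Aw; split; first by have := Aw i; rewrite /A' /= !inE eqxx; exact.
    move=> j /=; rewrite !inE => ji; have := Aw j.
    by rewrite /A' /= !inE (negbTE ji); exact.
  rewrite h; congr (_ * _); apply: eq_big => j; first by rewrite !inE.
  by rewrite inE /= /A' => /negbTE ->.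
have -> : \bigcap_(j in [set: 'I_n]) eps j @^-1` A j = eps i @^-1` A i `&` B.
  apply/seteqP; split => w /=.
    by move=> Aw; split => [|j _]; exact: Aw.
  move=> [Aiw Bw] j _; have [->//|ji] := eqVneq j i.
  by apply: Bw; rewrite /= !inE.
rewrite -PB.
have PBfin : (0 <= fine (P B))%R by rewrite fine_ge0.
have mAf : measurable_fun [set: R] ((fun x => (f x)%:E) \_ (A i)).
  apply/(measurable_restrictT _ (mA i)); apply: measurable_funTS.
  exact/measurable_EFinP.
have Af0 x : 0 <= ((fun x => (f x)%:E) \_ (A i)) x.
  by apply: erestrict_ge0 => y _; rewrite lee_fin.
transitivity (\int[mrestr P mB]_w ((fun x => (f x)%:E) \_ (A i)) (eps i w)).
  rewrite (@ge0_integral_density _ _ _ P \1_B) //.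
  - rewrite [LHS]integral_mkcond; apply: eq_integral => w _.
    have memA : (w \in eps i @^-1` A i) = (eps i w \in A i).
      by apply/idP/idP; rewrite !inE.
    rewrite /patch !in_setI memA indicE; case: (eps i w \in A i) => /=.
      by case: (w \in B); rewrite /= ?mule1 ?mule0.
    by rewrite mul0e.
  - by move=> C mC; rewrite integral_indic// setIC.
  - exact: (measurableT_comp mAf).
rewrite [RHS](_ : _ = (fine (P B))%:E *
    \int[normal_prob 0 sigma]_x ((fun x => (f x)%:E) \_ (A i)) x); last first.
  by rewrite fineK ?fin_num_measure// -integral_mkcond.
pose c : {nonneg R} := NngNum PBfin.
rewrite -[fine _]/(c%:num)%R -ge0_integral_mscale//.
pose ei : Omega -> measurableTypeR R := eps i.
have me : measurable_fun [set: Omega] ei by exact: (@measurable_funPT _ _ _ _ (eps i)).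
rewrite [RHS](eq_measure_integral (pushforward (mrestr P mB) ei)) /=.
  by rewrite ge0_integral_pushforward.
move=> C mC _; apply/esym.
rewrite /pushforward /mrestr indepB// /mscale /=.
by rewrite fineK ?fin_num_measure.
Qed.

(** Both sides integrate [h] against laws on tuples: that of the shifted noise under [P], and that
    of the noise under [P] reweighted by the likelihood of coordinate [i]. These agree on rectangles
    by independence and [normal_prob_shift]. *)
Lemma integral_shift_coordinate (i : 'I_n) (t : R) (h : n.-tuple R -> \bar R) :
  measurable_fun setT h -> (forall y, 0 <= h y) ->
  \int[P]_w h (shifted_noise (fun j => if j == i then t else 0%R) w) =
  \int[P]_w (h (shifted_noise (fun=> 0%R) w) *
     (expR ((t * eps i w - t ^+ 2 / 2) / sigma ^+ 2))%:E).
Proof.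
move=> mh h0; have [law indep] := Heps.
pose l x := expR ((t * x - t ^+ 2 / 2) / sigma ^+ 2).
have ml : measurable_fun [set: R] l.
  apply: measurableT_comp => //.
  apply: measurable_funM => //; apply: measurable_funB => //.
have l0 x : (0 <= l x)%R by exact: expR_ge0.
have mle : measurable_fun [set: Omega] (l \o eps i) by exact: measurableT_comp.
have [Q QE] := @density_measure _ _ _ P (l \o eps i) mle (fun w => l0 _).
pose s1 := shifted_noise (fun j => if j == i then t else 0%R).
pose s0 := shifted_noise (fun=> 0%R).
have ms1 : measurable_fun [set: Omega] s1 by exact: measurable_shifted_noise.
have ms0 : measurable_fun [set: Omega] s0 by exact: measurable_shifted_noise.
transitivity (\int[pushforward P s1]_y h y).
  by rewrite ge0_integral_pushforward.
transitivity (\int[pushforward Q s0]_y h y); last first.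
  rewrite ge0_integral_pushforward//.
  rewrite (@ge0_integral_density _ _ _ P (l \o eps i) mle (fun w => l0 _) Q) => //.
  - exact: measurableT_comp.
  - by move=> w; exact: h0.
apply: eq_measure_integral => B mB _.
apply: eq_measure_rectangles => //.
  by rewrite /= /pushforward preimage_setT probability_setT ltry.
move=> _ [A mA <-]; rewrite /= /pushforward QE !preimage_bigcap.
(* The shift is transferred to side [i] of the rectangle, so that independence applies to the noise
   itself. *)
transitivity (P (\bigcap_(j in [set` [set: 'I_n]%SET])
    (eps j @^-1` (if j == i then +%R^~ t @^-1` A j else A j)))).
  congr (P _); apply/seteqP; split => w /= + j _.
    move=> /(_ j I); rewrite /preimage/= tnth_mktuple.
    by case: eqP; rewrite ?add0r// addrC.
  move=> /(_ j); rewrite /= inE => /(_ isT).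
  by rewrite /preimage/= tnth_mktuple; case: eqP; rewrite ?add0r// addrC.
have mt (x : R) : measurable_fun [set: R] (+%R^~ x) by exact: measurable_funD.
have mAt j : measurable (if j == i then +%R^~ t @^-1` A j else A j).
  by case: ifP => // _; rewrite -[X in measurable X]setTI; exact: mt.
rewrite (indep _ _ mAt) (bigD1 i) ?inE//= eqxx.
have := law i _ (mAt i); rewrite eqxx /distribution /pushforward => ->.
rewrite normal_prob_shift//.
under [X in \int[P]_(x in X) _]eq_bigcapr => j _.
  rewrite (_ : _ @^-1` _ = eps j @^-1` A j); last first.
    by apply/funext => w /=; rewrite /preimage/= tnth_mktuple add0r.
  over.
rewrite (@independent_integral i A l)// muleC; congr (_ * _).
apply: eq_big => j; first by rewrite !inE.
by rewrite inE/= => /negbTE ->.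
Qed.

End cameron_martin.

(** * Likelihood of a mean vector against pure noise *)

Section likelihood.
Local Open Scope ereal_scope.
Context (R : realType) (d : measure_display) (Omega : measurableType d).
Variables (P : probability Omega R) (n : nat) (eps : 'I_n -> {RV P >-> R}).
Variable sigma : R.
Hypotheses (sigma0 : sigma != 0%R) (Heps : gaussian_noise eps sigma).

(** The density of N(theta, sigma^2 I) with respect to N(0, sigma^2 I), evaluated at the noise. *)
Definition likelihood (theta : 'I_n -> R) (w : Omega) : R :=
  expR ((\sum_j theta j * eps j w - (\sum_j theta j ^+ 2) / 2) / sigma ^+ 2).

Lemma measurable_likelihood theta :
  measurable_fun [set: Omega] (likelihood theta).
Proof.
apply: measurableT_comp => //; apply: measurable_funM => //.
apply: measurable_funB => //; apply: measurable_sum => j.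
exact: measurable_funM.
Qed.

Lemma cameron_martin_seq (s : seq 'I_n) (theta : 'I_n -> R)
    (h : n.-tuple R -> \bar R) : uniq s ->
  measurable_fun setT h -> (forall y, 0 <= h y) ->
  \int[P]_w h (shifted_noise eps (fun j => if j \in s then theta j else 0%R) w) =
  \int[P]_w (h (shifted_noise eps (fun=> 0%R) w) *
    (expR (\sum_(j <- s) (theta j * eps j w - theta j ^+ 2 / 2) / sigma ^+ 2))%:E).
Proof.
elim: s h => [|i s IHs] h /=.
  move=> _ mh h0; apply: eq_integral => w _.
  by rewrite big_nil expR0 mule1.
move=> /andP[si us] mh h0.
(* [h'] absorbs the shifts along the tail, so that only coordinate [i] remains to be shifted. *)
pose h' (y : n.-tuple R) :=
  h [tuple ((if j \in s then theta j else 0) + tnth y j)%R | j < n].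
have mh' : measurable_fun setT h'.
  apply: (measurableT_comp mh); apply/measurable_fun_tnthP => j.
  rewrite (_ : _ \o _ =
      fun y => ((if j \in s then theta j else 0) + tnth y j)%R); last first.
    by apply/funext => w /=; rewrite tnth_mktuple.
  by apply: measurable_funD => //; exact: measurable_tnth.
transitivity (\int[P]_w h' (shifted_noise eps
    (fun j => if j == i then theta i else 0%R) w)).
  apply: eq_integral => w _; rewrite /h'; congr h; apply: eq_from_tnth => j.
  rewrite !tnth_mktuple inE; have [->|_] := eqVneq j i.
    by rewrite (negbTE si) add0r.
  by rewrite add0r.
rewrite (integral_shift_coordinate sigma0 Heps)//; last by move=> y; exact: h0.
(* The weight of coordinate [i] joins the integrand before the induction hypothesis is used; as [i]
   is not in [s], the remaining shifts leave it unchanged. *)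
pose g (y : n.-tuple R) :=
  h y * (expR ((theta i * tnth y i - theta i ^+ 2 / 2) / sigma ^+ 2))%:E.
have mg : measurable_fun setT g.
  apply: emeasurable_funM => //; apply/measurable_EFinP.
  apply: measurableT_comp => //; apply: measurable_funM => //.
  apply: measurable_funB => //; apply: measurable_funM => //.
  exact: measurable_tnth.
transitivity (\int[P]_w g (shifted_noise eps
    (fun j => if j \in s then theta j else 0%R) w)).
  apply: eq_integral => w _; rewrite /g /h'; congr (h _ * _).
    by apply: eq_from_tnth => j; rewrite !tnth_mktuple add0r.
  by rewrite tnth_mktuple (negbTE si) add0r.
rewrite IHs//; last by move=> y; rewrite mule_ge0// lee_fin expR_ge0.
apply: eq_integral => w _; rewrite /g tnth_mktuple add0r -muleA -EFinM -expRD.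
by rewrite big_cons.
Qed.

Lemma cameron_martin (theta : 'I_n -> R) (h : n.-tuple R -> \bar R) :
  measurable_fun setT h -> (forall y, 0 <= h y) ->
  \int[P]_w h (shifted_noise eps theta w) =
  \int[P]_w (h (shifted_noise eps (fun=> 0%R) w) * (likelihood theta w)%:E).
Proof.
move=> mh h0.
have := @cameron_martin_seq (index_enum 'I_n) theta h (index_enum_uniq _) mh h0.
under eq_fun do under eq_fun do rewrite mem_index_enum.
move=> ->; apply: eq_integral => w _; congr (_ * (expR _)%:E).
by rewrite -mulr_suml sumrB -mulr_suml.
Qed.

Lemma integral_likelihood theta : \int[P]_w (likelihood theta w)%:E = 1.
Proof.
have := @cameron_martin theta (fun=> 1) (measurable_cst _) (fun=> lee01).
rewrite integral_cst// mul1e /= probability_setT => ->.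
by apply: eq_integral => w _; rewrite mul1e.
Qed.

End likelihood.

(** * Bayes risk under a product prior *)

Definition ffun_update (I : finType) (T : Type) (f : {ffun I -> T}) (j : I)
  (i : T) : {ffun I -> T} := [ffun j' => if j' == j then i else f j'].

(** Updating coordinate [j] is a bijection between the fibers of any two values, and [Phi] does not
    see it, so all fibers have the same sum. *)
Lemma sum_ffun_fiber (R : pzSemiRingType) (I T : finType) (j : I)
    (Phi : {ffun I -> T} -> R) (i : T) :
  (forall f i', Phi (ffun_update f j i') = Phi f) ->
  #|T|%:R * (\sum_(f : {ffun I -> T} | f j == i) Phi f) = \sum_f Phi f.
Proof.
move=> Phi_j; rewrite [RHS](partition_big (fun f : {ffun I -> T} => f j) predT)//=.
rewrite mulr_natl -sumr_const; apply: eq_bigr => i' _.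
rewrite [RHS](reindex_onto (fun f => ffun_update f j i')
    (fun f => ffun_update f j i)) /=; last first.
  move=> f /eqP <-; apply/ffunP => j'; rewrite !ffunE.
  by case: eqP => [->|].
apply: eq_big => [f|f _]; last by rewrite Phi_j.
rewrite ffunE !eqxx /=; apply/eqP/eqP => [<-|<-]; last by rewrite !ffunE eqxx.
by apply/ffunP => j'; rewrite !ffunE; case: eqP => [->|].
Qed.

Section product_prior.
Context (R : realType) (n k M : nat).
Variable u : 'I_k -> 'I_M -> 'I_n -> R.
Notation F := {ffun 'I_k -> 'I_M}.

Definition block_mean (f : F) (l : 'I_n) : R := \sum_j u j (f j) l.

(** The reference mean for the options of block [j]; it does not depend on [f j]. *)
Definition block_base (f : F) (j : 'I_k) (l : 'I_n) : R :=
  \sum_(j' | j' != j) u j' (f j') l.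

Lemma block_meanE f j l : block_mean f l = block_base f j l + u j (f j) l.
Proof. by rewrite /block_mean (bigD1 j)//= addrC. Qed.

Lemma block_base_update f j i l :
  block_base (ffun_update f j i) j l = block_base f j l.
Proof. by apply: eq_bigr => j' /negbTE j'j; rewrite ffunE j'j. Qed.

Variables (delta : R) (z : 'I_n -> R).
Hypotheses (delta0 : 0 <= delta)
  (sep : forall f g : F,
     delta * (\sum_j (f j != g j))%:R <=
     \sum_l (block_mean f l - block_mean g l) ^+ 2).

(* The nearest mean [ghat] to [z] satisfies
   [|theta_f - theta_ghat|^2 <= 4 |z - theta_f|^2]. *)
Lemma nearest_mean_separation : F ->
  exists ghat : F, forall f : F,
    delta / 4 * (\sum_j (f j != ghat j))%:R <=
    \sum_l (z l - block_mean f l) ^+ 2.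
Proof.
move=> f0; pose dist f := \sum_l (z l - block_mean f l) ^+ 2.
have [ghat _ ghat_min] := @arg_minP _ R F f0 predT dist isT.
exists ghat => f; have {}ghat_min := ghat_min f isT.
suff : \sum_l (block_mean f l - block_mean ghat l) ^+ 2 <=
    2 * dist f + 2 * dist ghat.
  have := sep f ghat; rewrite -/(dist f) => h1 h2.
  by rewrite mulrAC; lra.
rewrite !mulr_sumr -big_split; apply: ler_sum => l _ /=.
set a := z l; set b := block_mean f l; set c := block_mean ghat l.
(* This is [(b - c)^2 <= 2 (a - b)^2 + 2 (a - c)^2], by the parallelogram identity. *)
have : 0 <= (a - b + (a - c)) ^+ 2 by exact: sqr_ge0.
by rewrite !sqrrD; nra.
Qed.

Hypothesis M0 : (0 < M)%N.
Variables (w : 'I_n -> R) (sigma : R).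
Hypothesis sigma0 : sigma != 0.

Let L (theta : 'I_n -> R) : R :=
  expR ((\sum_l theta l * w l - (\sum_l theta l ^+ 2) / 2) / sigma ^+ 2).

Let L_ge0 theta : 0 <= L theta. Proof. exact: expR_ge0. Qed.

(** Squaring the likelihood ratio of block [j] doubles the block: [L (block_base f j)] times this
    square is the likelihood of [twice f j], up to the factor [K j (f j)]. *)
Let twice (f : F) j l := block_base f j l + 2 * u j (f j) l.

(** The second moment, under the reference mean, of the likelihood ratio of option [i]. *)
Let K j i := expR ((\sum_l u j i l ^+ 2) / sigma ^+ 2).

Lemma likelihood_tilt (f : F) (j : 'I_k) :
  L (block_mean f) = L (block_base f j) *
    (expR ((\sum_l u j (f j) l * w l - \sum_l block_base f j l * u j (f j) l -
       (\sum_l u j (f j) l ^+ 2) / 2) / sigma ^+ 2)) /\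
  K j (f j) * L (twice f j) = L (block_base f j) *
    (expR ((\sum_l u j (f j) l * w l - \sum_l block_base f j l * u j (f j) l -
       (\sum_l u j (f j) l ^+ 2) / 2) / sigma ^+ 2)) ^+ 2.
Proof.
split; rewrite /L /K -?expRM_natl -!expRD; congr expR.
  have -> : \sum_l block_mean f l * w l =
      \sum_l block_base f j l * w l + \sum_l u j (f j) l * w l.
    by rewrite -big_split; apply: eq_bigr => l _; rewrite /= (block_meanE _ j); ring.
  have -> : \sum_l block_mean f l ^+ 2 = \sum_l block_base f j l ^+ 2 +
      2 * (\sum_l block_base f j l * u j (f j) l) + \sum_l u j (f j) l ^+ 2.
    rewrite mulr_sumr -!big_split; apply: eq_bigr => l _.
    by rewrite /= (block_meanE _ j); ring.
  by field.
have -> : \sum_l twice f j l * w l =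
    \sum_l block_base f j l * w l + 2 * \sum_l u j (f j) l * w l.
  rewrite mulr_sumr -big_split; apply: eq_bigr => l _.
  by rewrite /= /twice; ring.
have -> : \sum_l twice f j l ^+ 2 = \sum_l block_base f j l ^+ 2 +
    4 * (\sum_l block_base f j l * u j (f j) l) + 4 * \sum_l u j (f j) l ^+ 2.
  rewrite !mulr_sumr -!big_split; apply: eq_bigr => l _.
  by rewrite /= /twice; ring.
by field.
Qed.

(* [D f j = L (block_base f j) * (l - 1)^2 / M], with [l] the likelihood ratio
   of [block_mean f] to [block_base f j]. *)
Let D (f : F) j := (K j (f j) * L (twice f j) - 2 * L (block_mean f) +
  L (block_base f j)) / M%:R.

Let M0R : 0 < M%:R :> R. Proof. by rewrite ltr0n. Qed.

Lemma chi2_ge0 f j : 0 <= D f j.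
Proof.
rewrite /D; have [-> ->] := likelihood_tilt f j; set e := expR _.
apply: divr_ge0; last exact: ltW.
rewrite (_ : _ + _ = L (block_base f j) * (e - 1) ^+ 2); last by ring.
by rewrite mulr_ge0 ?sqr_ge0.
Qed.

(* AM-GM: [l - 1 <= M/4 + (l - 1)^2 / M]. *)
Lemma likelihood_le_chi2 f j :
  L (block_mean f) <= (1 + M%:R / 4) * L (block_base f j) + D f j.
Proof.
rewrite /D; have [-> ->] := likelihood_tilt f j; set e := expR _.
have b0 := L_ge0 (block_base f j).
rewrite -subr_ge0 (_ : _ - _ =
    L (block_base f j) * (M%:R / 2 - (e - 1)) ^+ 2 / M%:R); last first.
  by field; rewrite gt_eqF.
by apply: divr_ge0; [exact: mulr_ge0 (L_ge0 _) (sqr_ge0 _)|exact: ltW].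
Qed.

(** The total weight minus that of the fiber [f j = i], where the latter is controlled by
    [likelihood_le_chi2]. *)
Lemma sum_likelihood_wrong_block j i :
  \sum_f (L (block_mean f) - (M%:R^-1 + 1 / 4) * L (block_base f j) - D f j) <=
  \sum_(f : F | f j != i) L (block_mean f).
Proof.
have fiber : \sum_(f : F | f j == i) L (block_mean f) <=
    \sum_f ((M%:R^-1 + 1 / 4) * L (block_base f j) + D f j).
  rewrite big_split /=; apply: (@le_trans _ _ (\sum_(f : F | f j == i)
      ((1 + M%:R / 4) * L (block_base f j) + D f j))).
    by apply: ler_sum => f _; exact: likelihood_le_chi2.
  rewrite big_split /=; apply: lerD; last first.
    (* The chi-square terms are nonnegative, so their sum is enlarged to all [f]; the division by
       [M] in [D] makes this affordable. *)
    rewrite [leRHS](bigID (fun f : F => f j == i))/= lerDl.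
    by apply: sumr_ge0 => f _; exact: chi2_ge0.
  (* Reference likelihoods ignore [f j], so the fiber carries a share [1 / M] of their sum, and
     [(1 + M / 4) / M = 1 / M + 1 / 4]. *)
  rewrite -!mulr_sumr -(@sum_ffun_fiber _ _ _ j _ i); last first.
    move=> f i'; congr (L _); apply/funext => l.
    exact: block_base_update.
  rewrite card_ord mulrA; apply: ler_wpM2r.
    by apply: sumr_ge0 => f _.
  by rewrite le_eqVlt; apply/orP; left; apply/eqP; field; rewrite gt_eqF.
rewrite [leRHS](_ : _ = \sum_f L (block_mean f) -
    \sum_(f : F | f j == i) L (block_mean f)); last first.
  by rewrite [in RHS](bigID (fun f : F => f j == i))/= addrAC subrr add0r.
rewrite sumrB sumrB -addrA lerD2l -opprD lerN2.
by rewrite big_split/= in fiber.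
Qed.

Variable kappa : R.
Hypothesis K_le : forall j i, K j i <= kappa.

(** Each block where [f] differs from the nearest candidate costs [delta / 4]; exchanging sums
    leaves, block by block, the weight of the wrong means. Negative terms are moved across so that
    all coefficients are nonnegative, ready for integration. *)
Lemma bayes_pointwise :
  delta / 4 * (\sum_(fj : F * 'I_k) (1 + 2 / M%:R) * L (block_mean fj.1)) <=
  \sum_f (\sum_l (z l - block_mean f l) ^+ 2) * L (block_mean f) +
  delta / 4 * (\sum_(fj : F * 'I_k) (2 / M%:R + 1 / 4) * L (block_base fj.1 fj.2)
   + \sum_(fj : F * 'I_k) (kappa / M%:R) * L (twice fj.1 fj.2)).
Proof.
have [ghat ghatP] := nearest_mean_separation [ffun=> Ordinal M0].
rewrite -lerBlDr -mulrBr.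
apply: (@le_trans _ _ (delta / 4 *
    \sum_j \sum_(f : F | f j != ghat j) L (block_mean f))); last first.
  under eq_bigr do rewrite big_mkcond.
  rewrite exchange_big mulr_sumr; apply: ler_sum => f _ /=.
  rewrite (_ : \sum_j _ = (\sum_j (f j != ghat j))%:R * L (block_mean f)).
    rewrite mulrA. apply: (ler_wpM2r (L_ge0 (block_mean f))); exact: ghatP.
  rewrite natr_sum mulr_suml; apply: eq_bigr => j _.
  by case: (f j != ghat j); rewrite ?mul1r ?mul0r.
apply: ler_wpM2l; first by rewrite divr_ge0.
apply: (@le_trans _ _ (\sum_j \sum_f (L (block_mean f) -
   (M%:R^-1 + 1 / 4) * L (block_base f j) - D f j))); last first.
  by apply: ler_sum => j _; exact: sum_likelihood_wrong_block.
rewrite exchange_big pair_big/= -big_split -sumrB.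
apply: ler_sum => -[f j] _ /=.
(* Termwise, the two sides differ only by the replacement of [K] by its bound [kappa]. *)
rewrite -subr_ge0 /D (_ : _ - _ =
    (kappa - K j (f j)) * L (twice f j) / M%:R); last first.
  by field; rewrite gt_eqF.
apply: divr_ge0; last exact: ltW.
by apply: mulr_ge0 (L_ge0 _); rewrite subr_ge0.
Qed.

End product_prior.

(** * Integration of the pointwise bound *)

Section bayes_risk.
Local Open Scope ereal_scope.
Context (R : realType) (d : measure_display) (Omega : measurableType d).
Variables (P : probability Omega R) (n : nat) (eps : 'I_n -> {RV P >-> R}).
Variable sigma : R.
Hypotheses (sigma0 : sigma != 0%R) (Heps : gaussian_noise eps sigma).

Lemma measurable_sum_likelihood (I : finType) (c : R)
    (theta : I -> 'I_n -> R) :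
  measurable_fun [set: Omega]
    (fun w => \sum_i c * likelihood eps sigma (theta i) w)%R.
Proof.
apply: measurable_sum => i; apply: measurable_funM => //.
exact: measurable_likelihood.
Qed.

Lemma integral_sum_likelihood (I : finType) (c : R) (theta : I -> 'I_n -> R) :
  (0 <= c)%R ->
  \int[P]_w (\sum_i c * likelihood eps sigma (theta i) w)%:E =
  (c * #|I|%:R)%:E.
Proof.
move=> c0; under eq_integral do rewrite -sumEFin.
have mL i : measurable_fun [set: Omega]
    (fun w => (likelihood eps sigma (theta i) w)%:E).
  by apply/measurable_EFinP; exact: measurable_likelihood.
rewrite ge0_integral_sum//; last 2 first.
- move=> i; apply/measurable_EFinP; apply: measurable_funM => //.
  exact: measurable_likelihood.
- by move=> i w _; rewrite lee_fin mulr_ge0 ?expR_ge0.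
transitivity (\sum_(i : I) c%:E).
  apply: eq_bigr => i _; under eq_integral do rewrite EFinM.
  rewrite ge0_integralZl_EFin//; last by move=> w _; rewrite lee_fin expR_ge0.
  by rewrite integral_likelihood// mule1.
by rewrite sumEFin sumr_const mulr_natr.
Qed.

Variables (k M : nat) (u : 'I_k -> 'I_M -> 'I_n -> R) (delta : R).
Notation F := {ffun 'I_k -> 'I_M}.
Hypotheses (delta0 : (0 <= delta)%R) (M0 : (0 < M)%N).
(* [18 / 25] lies between [1 / sqrt 2] and [3 / 4]: being above the first makes
   [close] satisfiable with [exp K = sqrt M] already at [M = 2], being below the
   second makes the resulting bound positive. *)
Hypotheses
  (sep : forall f g : F,
     (delta * (\sum_j (f j != g j))%:R <=
      \sum_l (block_mean u f l - block_mean u g l) ^+ 2)%R)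
  (close : forall j i,
     (expR ((\sum_l u j i l ^+ 2) / sigma ^+ 2) <= 18 / 25 * M%:R)%R).

(** Cameron-Martin brings all risks to a single integral against pure noise, where every mean faces
    the same estimate [z]. In the pointwise bound each likelihood then integrates to 1. *)
Lemma sum_risk_ge (yhat : n.-tuple R -> n.-tuple R) :
  measurable_fun [set: n.-tuple R] yhat ->
  (3 / 400 * delta * k%:R * #|F|%:R)%:E <=
  \sum_f \int[P]_w (\sum_l (tnth (yhat (shifted_noise eps (block_mean u f) w)) l
     - block_mean u f l) ^+ 2)%:E.
Proof.
move=> myhat.
pose z w l := tnth (yhat (shifted_noise eps (fun=> 0%R) w)) l.
pose L theta w := likelihood eps sigma theta w.
pose S f y := (\sum_l (tnth (yhat y) l - block_mean u f l) ^+ 2)%R.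
have mS f : measurable_fun [set: n.-tuple R] (S f).
  apply: measurable_sum => l; apply: measurable_funX; apply: measurable_funB => //.
  exact: (measurableT_comp (measurable_tnth l)).
have S0 f y : (0 <= S f y)%R by apply: sumr_ge0 => l _; exact: sqr_ge0.
have mS0 f : measurable_fun [set: Omega] (fun w => S f (shifted_noise eps (fun=> 0%R) w)).
  by apply: (measurableT_comp (mS f)); exact: measurable_shifted_noise.
have -> : \sum_f \int[P]_w (S f (shifted_noise eps (block_mean u f) w))%:E =
    \int[P]_w (\sum_f S f (shifted_noise eps (fun=> 0%R) w) * L (block_mean u f) w)%:E.
  under [RHS]eq_integral do rewrite -sumEFin.
  rewrite ge0_integral_sum//; last 2 first.
  - move=> f; apply/measurable_EFinP; apply: measurable_funM => //.
    exact: measurable_likelihood.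
  - by move=> f w _; rewrite lee_fin mulr_ge0 ?expR_ge0.
  apply: eq_bigr => f _.
  rewrite (@cameron_martin _ _ _ _ _ _ _ sigma0 Heps _ (fun y => (S f y)%:E)).
  - by apply: eq_integral => w _; rewrite EFinM.
  - exact/measurable_EFinP.
  - by move=> y; rewrite lee_fin.
pose kappa : R := (18 / 25 * M%:R)%R.
have M0R : (0 < M%:R :> R)%R by rewrite ltr0n.
have kappa0 : (0 <= kappa)%R by rewrite /kappa mulr_ge0// ?divr_ge0// ltW.
pose I := (F * 'I_k)%type.
pose A1 w := (\sum_(fj : I) (delta / 4 * (1 + 2 / M%:R)) * L (block_mean u fj.1) w)%R.
pose B1 w := (\sum_(fj : I) (delta / 4 * (2 / M%:R + 1 / 4)) *
  L (block_base u fj.1 fj.2) w)%R.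
pose B2 w := (\sum_(fj : I) (delta / 4 * (kappa / M%:R)) *
  L (fun l => block_base u fj.1 fj.2 l + 2 * u fj.2 (fj.1 fj.2) l) w)%R.
pose G w := (\sum_f S f (shifted_noise eps (fun=> 0%R) w) * L (block_mean u f) w)%R.
have pointwise w : (A1 w <= G w + (B1 w + B2 w))%R.
  have := @bayes_pointwise R n k M u delta (z w) delta0 sep M0
    (fun l => eps l w) sigma sigma0 kappa close.
  rewrite mulrDr !mulr_sumr.
  rewrite /A1 /B1 /B2 /G /S /L /likelihood.
  under eq_bigr do rewrite mulrA.
  under [X in (_ <= _ + (X + _))%R -> _]eq_bigr do rewrite mulrA.
  by under [X in (_ <= _ + (_ + X))%R -> _]eq_bigr do rewrite mulrA.
have c1 : (0 <= delta / 4 * (1 + 2 / M%:R))%R.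
  by rewrite mulr_ge0 ?divr_ge0// addr_ge0// divr_ge0// ltW.
have c2 : (0 <= delta / 4 * (2 / M%:R + 1 / 4))%R.
  by rewrite mulr_ge0 ?divr_ge0// addr_ge0// divr_ge0// ltW.
have c3 : (0 <= delta / 4 * (kappa / M%:R))%R.
  by rewrite mulr_ge0 ?divr_ge0// divr_ge0// ltW.
have mG : measurable_fun [set: Omega] G.
  apply: measurable_sum => f; apply: measurable_funM => //.
  exact: measurable_likelihood.
have B10 w : (0 <= B1 w)%R.
  by apply: sumr_ge0 => fj _; rewrite mulr_ge0 ?expR_ge0.
have B20 w : (0 <= B2 w)%R.
  by apply: sumr_ge0 => fj _; rewrite mulr_ge0 ?expR_ge0.
have A10 w : (0 <= A1 w)%R.
  by apply: sumr_ge0 => fj _; rewrite mulr_ge0 ?expR_ge0.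
have G0 w : (0 <= G w)%R.
  by apply: sumr_ge0 => f _; rewrite mulr_ge0 ?expR_ge0.
have mB1 : measurable_fun [set: Omega] B1 by exact: measurable_sum_likelihood.
have mB2 : measurable_fun [set: Omega] B2 by exact: measurable_sum_likelihood.
have mA1 : measurable_fun [set: Omega] A1 by exact: measurable_sum_likelihood.
have : \int[P]_w (A1 w)%:E <= \int[P]_w ((G w)%:E + ((B1 w)%:E + (B2 w)%:E)).
  apply: ge0_le_integral => //.
  - by move=> w _; rewrite lee_fin.
  - exact/measurable_EFinP.
  - by apply/measurable_EFinP; apply: measurable_funD => //; exact: measurable_funD.
  - by move=> w _; rewrite -!EFinD lee_fin.
rewrite ge0_integralD//; last 4 first.
- by move=> w _; rewrite lee_fin.
- exact/measurable_EFinP.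
- by move=> w _; rewrite -EFinD lee_fin addr_ge0.
- by apply/measurable_EFinP; exact: measurable_funD.
rewrite ge0_integralD//; last 4 first.
- by move=> w _; rewrite lee_fin.
- exact/measurable_EFinP.
- by move=> w _; rewrite lee_fin.
- exact/measurable_EFinP.
rewrite !integral_sum_likelihood// -leeBlDr -?EFinD//; apply: le_trans.
(* The coefficients leave [(1 + 2 / M) - (2 / M + 1 / 4) - 18 / 25 = 3 / 100], and the factor
   [delta / 4] gives [3 / 400]. *)
rewrite lee_fin card_prod card_ord natrM le_eqVlt; apply/orP; left; apply/eqP.
by rewrite /kappa; field; rewrite gt_eqF.
Qed.

End bayes_risk.

(** * Minimax bounds *)

Section euclidean_norm.
Context (R : realType).

Lemma sqr_norm2 (n : nat) (v : 'cV[R]_n) : norm2 v ^+ 2 = \sum_l v l 0 ^+ 2.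
Proof. by rewrite /norm2 sqr_sqrtr// sumr_ge0// => l _; exact: sqr_ge0. Qed.

Lemma sqr_norm2Z (n : nat) (a : R) (v : 'cV[R]_n) :
  norm2 (a *: v) ^+ 2 = a ^+ 2 * norm2 v ^+ 2.
Proof.
by rewrite !sqr_norm2 mulr_sumr; apply: eq_bigr => l _; rewrite mxE exprMn.
Qed.

Lemma sum_sqr_le_norm2 (p k : nat) (h : 'I_k -> 'I_p) (b : 'cV[R]_p) :
  injective h -> \sum_j b (h j) 0 ^+ 2 <= norm2 b ^+ 2.
Proof.
move=> h_inj; rewrite sqr_norm2.
rewrite -(big_imset (fun l => b l 0 ^+ 2) (in2W h_inj : {in 'I_k &, injective h})).
rewrite [leRHS](bigID [in [set h x | x in 'I_k]%SET])/= lerDl.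
by apply: sumr_ge0 => l _; exact: sqr_ge0.
Qed.

Lemma norm0_eq0 (p : nat) (b : 'cV[R]_p) : norm0 b = 0 -> b = 0.
Proof.
move=> /eqP; rewrite /norm0 => /pred0P b0; apply/colP => l; rewrite mxE.
by have := b0 l; rewrite /= => /negbFE/eqP.
Qed.

Lemma norm0B (p : nat) (b c : 'cV[R]_p) : (norm0 (b - c)%R <= norm0 b + norm0 c)%N.
Proof.
rewrite /norm0 -[leqRHS]cardUI; apply: leq_trans (leq_addr _ _).
apply: subset_leq_card; apply/fintype.subsetP => l; rewrite !inE !mxE.
by apply: contraR; rewrite negb_or !negbK => /andP[/eqP -> /eqP ->]; rewrite subr0.
Qed.

Lemma norm0Z_le (p : nat) (a : R) (b : 'cV[R]_p) : (norm0 (a *: b)%R <= norm0 b)%N.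
Proof.
apply: subset_leq_card; apply/fintype.subsetP => l; rewrite !inE !mxE.
by apply: contra => /eqP ->; rewrite mulr0.
Qed.

Lemma norm0_sum_delta (p k : nat) (h : 'I_k -> 'I_p) (s : 'I_k -> R) :
  (norm0 (\sum_j s j *: delta_mx (h j) 0 : 'cV[R]_p)%R <= k)%N.
Proof.
apply: (@leq_trans #|[set h j | j in [set: 'I_k]%SET]%SET|).
  apply: subset_leq_card; apply/fintype.subsetP => l; rewrite !inE summxE.
  apply: contraR => lh; rewrite big1// => j _; rewrite !mxE.
  have [lhj|] := eqVneq l (h j); last by rewrite mulr0.
  by move: lh; rewrite lhj imset_f ?inE.
by rewrite (leq_trans (leq_imset_card _ _))// cardsT card_ord.
Qed.

End euclidean_norm.

(** * Bounds given by the sparse eigenvalues *)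

Section sparse_eigenvalue_bounds.
Context (R : realType) (n p : nat) (X : 'M[R]_(n, p)).

Lemma phi_min_ge0 (k : nat) : 0 <= phi_min X k.
Proof.
(* Without admissible vectors, [inf] takes its default value 0. *)
rewrite /phi_min; have [->|/set0P ne] := eqVneq (sparse_quotients X k) set0.
  by rewrite inf0.
by apply: lb_le_inf => // _ [b _ <-]; rewrite divr_ge0 ?sqr_ge0.
Qed.

Lemma norm2_gt0 (b : 'cV[R]_p) : (0 < norm0 b)%N -> 0 < norm2 b ^+ 2.
Proof.
move=> /card_gt0P[l]; rewrite inE => bl; rewrite sqr_norm2 (bigD1 l)//=.
rewrite ltr_wpDr//; first by apply: sumr_ge0 => j _; exact: sqr_ge0.
by rewrite exprn_even_gt0.
Qed.

Lemma phi_min_le (k : nat) (b : 'cV[R]_p) : (norm0 b <= k)%N ->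
  phi_min X k * norm2 b ^+ 2 <= norm2 (X *m b) ^+ 2.
Proof.
(* The zero vector has no quotient and is treated apart. *)
move=> bk; have [b0|b0] := posnP (norm0 b).
  rewrite (norm0_eq0 b0) mulmx0 !sqr_norm2.
  under eq_bigr do rewrite mxE expr0n; rewrite sumr_const mul0rn mulr0.
  by apply: sumr_ge0 => l _; exact: sqr_ge0.
rewrite -ler_pdivlMr ?norm2_gt0//; apply: ge_inf; last by exists b => //=; rewrite b0.
by exists 0 => _ [c _ <-]; rewrite divr_ge0 ?sqr_ge0.
Qed.

(** Each entry of [b] is at most its norm. Boundedness makes [sup] a genuine upper bound instead of
    a default value. *)
Lemma sparse_quotients_ubound (k : nat) : has_ubound (sparse_quotients X k).
Proof.
exists (\sum_l (\sum_j `|X l j|) ^+ 2) => _ [b /= /andP[b0 _] <-].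
rewrite ler_pdivrMr ?norm2_gt0// sqr_norm2 mulr_suml; apply: ler_sum => l _.
rewrite -exprMn -[leLHS]real_normK ?num_real// ler_sqr ?nnegrE//; last first.
  by rewrite mulr_ge0 ?sqrtr_ge0 ?sumr_ge0.
rewrite mxE (le_trans (ler_norm_sum _ _ _))// mulr_suml; apply: ler_sum => j _.
rewrite normrM ler_wpM2l// -[leRHS]ger0_norm ?sqrtr_ge0//.
rewrite -ler_sqr ?nnegrE// !real_normK ?num_real// sqr_norm2 (bigD1 j)//= lerDl.
by apply: sumr_ge0 => i _; exact: sqr_ge0.
Qed.

(** A basis vector is 1-sparse of norm 1, so its quotient is the squared norm of a column. *)
Lemma phi_max_ge (k : nat) (j : 'I_p) : (0 < k)%N ->
  norm2 (X *m delta_mx j 0) ^+ 2 <= phi_max X k.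
Proof.
move=> k0; apply: ub_le_sup; first exact: sparse_quotients_ubound.
have n1 : norm0 (delta_mx j 0 : 'cV[R]_p) = 1%N.
  rewrite -[RHS](card1 j); apply: eq_card => l; rewrite !inE mxE eqxx andbT.
  by case: (l == j); rewrite ?oner_neq0 ?eqxx.
exists (delta_mx j 0); first by rewrite /= n1.
rewrite (_ : norm2 (delta_mx j 0) ^+ 2 = 1) ?divr1// sqr_norm2 (bigD1 j)//=.
rewrite mxE !eqxx expr1n big1 ?addr0// => l /negbTE lj.
by rewrite mxE lj expr0n.
Qed.

End sparse_eigenvalue_bounds.

(** * Reduction to a finite family of sparse candidates *)

Section minimax_bounds.
Context (R : realType) (n p : nat) (X : 'M[R]_(n, p)) (sigma : R).
Context (d : measure_display) (Omega : measurableType d).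
Variables (P : probability Omega R) (eps : 'I_n -> {RV P >-> R}).
Hypotheses (sigma_gt0 : 0 < sigma) (Heps : gaussian_noise eps sigma).

(** The worst-case risk dominates the average risk over the candidates, all of them [p0]-sparse. *)
Lemma minimax_risk_ge (p0 k M : nat) (v : 'I_k -> 'I_M -> 'cV[R]_p)
    (delta : R) : 0 <= delta -> (0 < M)%N ->
  (forall f : {ffun 'I_k -> 'I_M}, (norm0 (\sum_j v j (f j))%R <= p0)%N) ->
  (forall f g : {ffun 'I_k -> 'I_M},
     delta * (\sum_j (f j != g j))%:R <=
     norm2 (X *m (\sum_j v j (f j) - \sum_j v j (g j))) ^+ 2) ->
  (forall j i, expR (norm2 (X *m v j i) ^+ 2 / sigma ^+ 2) <= 18 / 25 * M%:R) ->
  ((3 / 400 * delta * k%:R)%:E <= minimax_risk eps X p0)%E.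
Proof.
move=> delta0 M0 sparse sep close.
pose b (f : {ffun 'I_k -> 'I_M}) := \sum_j v j (f j).
pose u j i l := (X *m v j i) l 0.
have uE f l : block_mean u f l = (X *m b f) l 0.
  by rewrite /block_mean mulmx_sumr summxE.
apply: le_ereal_inf_tmp => _ [yhat /= myhat <-].
set s := ereal_sup _.
have risk_le f : (risk eps X yhat (b f) <= s)%E.
  by apply: ereal_sup_ubound; exists (b f) => //=; exact: sparse.
have risk_ge0 f : (0 <= risk eps X yhat (b f))%E.
  by apply: expectation_ge0 => w; exact: sqr_ge0.
have sum_ge : ((3 / 400 * delta * k%:R * #|{ffun 'I_k -> 'I_M}|%:R)%:E <=
    \sum_(f : {ffun 'I_k -> 'I_M}) risk eps X yhat (b f))%E.
  apply: le_trans (@sum_risk_ge R d Omega P n eps sigma _ Heps k M u delta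
    delta0 M0 _ _ yhat myhat) _.
  - by rewrite gt_eqF.
  - move=> f g; apply: le_trans (sep f g) _; rewrite sqr_norm2.
    rewrite le_eqVlt; apply/orP; left; apply/eqP; apply: eq_bigr => l _.
    by rewrite mulmxBr mxE [X in _ + X]mxE !uE.
  - by move=> j i; have := close j i; rewrite sqr_norm2.
  apply: lee_sum => f _; rewrite /risk expectation.unlock.
  rewrite le_eqVlt; apply/orP; left; apply/eqP.
  apply: eq_integral => w _; rewrite sqr_norm2; congr (_%:E).
  apply: eq_bigr => l _; rewrite uE [in RHS]mxE [X in _ = (X + _) ^+ 2]mxE.
  rewrite [X in _ = (_ + X) ^+ 2]mxE; congr ((tnth (yhat _) _ - _) ^+ 2).
  by apply: eq_from_tnth => i; rewrite !tnth_mktuple uE.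
have card0 : 0 < #|{ffun 'I_k -> 'I_M}|%:R :> R.
  by rewrite ltr0n; apply/card_gt0P; exists [ffun=> Ordinal M0].
have := le_trans sum_ge (lee_sum _ (fun f _ => risk_le f)).
have := le_trans (risk_ge0 [ffun=> Ordinal M0]) (risk_le _).
(* An infinite supremum is trivial, and [-oo] is excluded because risks are nonnegative. *)
case: s {risk_le} => [s||]; rewrite ?leey//.
move=> _; rewrite sumEFin !lee_fin sumr_const -[leRHS]mulr_natr.
by rewrite ler_pM2r.
Qed.

Variables (k M : nat) (c : 'I_k -> 'I_M -> 'I_p) (s : 'I_k -> 'I_M -> R).

(** Option [i] of block [j] is a single column [c j i] with coefficient [s j i]. The sparse regime
    varies the column, the dense one the coefficient. *)
Definition block_vector (f : {ffun 'I_k -> 'I_M}) : 'cV[R]_p :=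
  \sum_j s j (f j) *: delta_mx (c j (f j)) 0.

Lemma block_vector_entry (f : {ffun 'I_k -> 'I_M}) (j : 'I_k) (i : 'I_M) :
  (forall j j' i i', c j i = c j' i' -> j = j') ->
  block_vector f (c j i) 0 = s j (f j) * (c j i == c j (f j))%:R.
Proof.
move=> c_disj; rewrite summxE (bigD1 j)//= !mxE eqxx andbT.
rewrite big1 ?addr0// => j' jj'; rewrite !mxE.
case: eqP => [/c_disj jj|]; last by rewrite mulr0.
by move: jj'; rewrite jj eqxx.
Qed.

(** The candidates are scaled by the largest amplitude that keeps them hard to tell apart: [phi_max]
    bounds the length of one option from above, [phi_min] the distance between two means from below.
    Here [q] is the sparsity of differences. *)
Lemma minimax_risk_block (p0 q : nat) : (k <= p0)%N -> (1 < M)%N -> (0 < q)%N ->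
  (forall j i, s j i ^+ 2 <= 1) ->
  (forall f g : {ffun 'I_k -> 'I_M},
     (norm0 (block_vector f - block_vector g)%R <= q)%N) ->
  (forall f g : {ffun 'I_k -> 'I_M}, (\sum_j (f j != g j))%:R <=
     norm2 (block_vector f - block_vector g) ^+ 2) ->
  ((3 / 800 * sigma ^+ 2 * (phi_min X q / phi_max X q) *
     (k%:R * ln M%:R))%:E <= minimax_risk eps X p0)%E.
Proof.
move=> kp0 M1 q0 s1 sparse sep.
have M0 : (0 < M)%N by exact: ltnW.
have M2 : 2 <= M%:R :> R by rewrite ler_nat.
have lnM0 : 0 <= ln M%:R :> R by rewrite ln_ge0// (le_trans _ M2)// ler1n.
have sigma20 : 0 < sigma ^+ 2 by rewrite exprn_gt0.
have phi_max0 : (0 < k)%N -> 0 <= phi_max X q.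
  move=> k0; apply: le_trans (phi_max_ge X (c (Ordinal k0) (Ordinal M0)) q0).
  exact: sqr_ge0.
(* Without blocks the bound is 0, below any risk. *)
have [->|k0] := posnP k.
  rewrite mul0r mulr0; apply: le_ereal_inf_tmp => _ [yhat _ <-].
  apply: le_trans (ereal_sup_ubound _); last first.
    exists 0 => //=; rewrite /norm0 eq_card0// => i.
    by rewrite !inE mxE eqxx.
  by apply: expectation_ge0 => w; exact: sqr_ge0.
have {}phi_max0 := phi_max0 k0.
(* Chosen so that [a2 * phi_max X q = sigma^2 (ln M) / 2] when [phi_max X q] is nonzero; otherwise
   [a2] is 0. *)
pose a2 := sigma ^+ 2 * ln M%:R / 2 / phi_max X q.
have a20 : 0 <= a2 by rewrite !divr_ge0// mulr_ge0// ltW.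
pose a := Num.sqrt a2.
have aE : a ^+ 2 = a2 by rewrite sqr_sqrtr.
have sumE (f : {ffun 'I_k -> 'I_M}) : \sum_j a *: (s j (f j) *: delta_mx (c j (f j)) 0) =
    a *: block_vector f.
  by rewrite scaler_sumr.
have := @minimax_risk_ge p0 k M
  (fun j i => a *: (s j i *: delta_mx (c j i) 0)) (a2 * phi_min X q).
rewrite (_ : 3 / 400 * _ * _ = 3 / 800 * sigma ^+ 2 *
    (phi_min X q / phi_max X q) * (k%:R * ln M%:R)); last first.
  by rewrite /a2; set i := (phi_max X q)^-1; field.
apply => //.
- by rewrite mulr_ge0 ?phi_min_ge0.
- move=> f; rewrite sumE; apply: leq_trans (norm0Z_le _ _) _.
  exact: leq_trans (norm0_sum_delta _ _) kp0.
- move=> f g; rewrite !sumE -scalerBr -scalemxAr sqr_norm2Z aE -mulrA.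
  apply: ler_wpM2l => //; apply: le_trans (phi_min_le _ (sparse f g)).
  by apply: ler_wpM2l => //; exact: phi_min_ge0.
- move=> j i; apply: (@le_trans _ _ (expR (ln M%:R / 2))).
    rewrite ler_expR -!scalemxAr !sqr_norm2Z aE ler_pdivrMr//.
    apply: (@le_trans _ _ (a2 * phi_max X q)).
      apply: ler_wpM2l => //; rewrite -[leRHS]mul1r.
      by apply: ler_pM; rewrite ?sqr_ge0 ?phi_max_ge.
    rewrite /a2; have [->|phi_neq0] := eqVneq (phi_max X q) 0.
      by rewrite mulr0 mulr_ge0 ?divr_ge0// ltW.
    by rewrite divfK// -mulrA [leLHS]mulrC.
  (* With [e = sqrt M], the claim [e <= 18 / 25 * e^2] means [e >= 25 / 18], which holds as
     [25 / 18 < sqrt 2]. *)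
  have eE : expR (ln M%:R / 2) ^+ 2 = M%:R :> R.
    by rewrite -expRM_natl mulrC divfK// lnK// posrE ltr0n.
  have e0 : 0 <= expR (ln M%:R / 2) :> R by exact: expR_ge0.
  by move: eE e0; set e := expR _ => eE e0; rewrite -eE; nra.
Qed.

End minimax_bounds.

(** * Sparse and dense regimes *)

Section regimes.
Context (R : realType) (n p : nat) (X : 'M[R]_(n, p)) (sigma : R).
Context (d : measure_display) (Omega : measurableType d).
Variables (P : probability Omega R) (eps : 'I_n -> {RV P >-> R}).
Hypotheses (sigma_gt0 : 0 < sigma) (Heps : gaussian_noise eps sigma).

(** Block [j] consists of [M] consecutive columns, one of which is selected with coefficient 1. Two
    selections may be disjoint, hence the sparsity [2 * p0] of differences. *)
Lemma minimax_risk_sparse (p0 : nat) : (0 < p0)%N -> (2 * p0 <= p)%N ->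
  ((3 / 800 * sigma ^+ 2 * (phi_min X (2 * p0) / phi_max X (2 * p0)) *
     (p0%:R * ln (p %/ p0)%:R))%:E <= minimax_risk eps X p0)%E.
Proof.
move=> p00 pp0; set M := (p %/ p0)%N.
have M1 : (1 < M)%N by rewrite leq_divRL.
have c_lt (j : 'I_p0) (i : 'I_M) : (j * M + i < p)%N.
  apply: (@leq_trans (p0 * M)); last by rewrite mulnC leq_divM.
  apply: (@leq_trans (j.+1 * M)); first by rewrite mulSn addnC ltn_add2r.
  by rewrite leq_mul2r (ltn_ord j) orbT.
pose c j i := Ordinal (c_lt j i).
have c_inj j j' i i' : c j i = c j' i' -> j = j' /\ i = i'.
  move=> /(congr1 val) /= ji.
  have jj' : j = j'.
    apply: val_inj; have := congr1 (divn^~ M) ji.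
    by rewrite !divnMDl ?(ltnW M1)// !divn_small// !addn0.
  by split=> //; apply/val_inj/eqP; rewrite -(eqn_add2l (j * M)) {2}jj' ji.
have c_disj j j' i i' (e : c j i = c j' i') : j = j' := proj1 (c_inj _ _ _ _ e).
apply: (@minimax_risk_block _ _ _ X sigma d Omega P eps sigma_gt0 Heps
  p0 M c (fun _ _ => 1)) => //.
- by rewrite muln_gt0.
- move=> f g; apply: leq_trans (norm0B _ _) _.
  by rewrite mul2n -addnn; apply: leq_add; exact: norm0_sum_delta.
(* Only the columns selected by [f] are counted: each contributes 1 where [g] selects another column
   of the block. *)
- move=> f g; have h_inj : injective (fun j => c j (f j)) by move=> j j' /c_disj.
  apply: le_trans (sum_sqr_le_norm2 _ h_inj).
  rewrite natr_sum; apply: ler_sum => j _; rewrite mxE [X in _ + X]mxE.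
  rewrite !block_vector_entry// eqxx; have [->|fg] := eqVneq (f j) (g j).
    by rewrite eqxx subrr expr0n.
  rewrite (_ : (c j (f j) == c j (g j)) = false) ?mulr0 ?subr0 ?mulr1 ?expr1n//.
  by apply/negbTE; apply: contra fg => /eqP /c_inj[_ ->].
Qed.

(** Each block is one column, switched on or off. All differences live on the same [p0] columns, so
    the sparsity does not double. *)
Lemma minimax_risk_dense (p0 : nat) : (0 < p0)%N -> (p0 <= p)%N ->
  ((3 / 800 * sigma ^+ 2 * (phi_min X p0 / phi_max X p0) *
     (p0%:R * ln 2%:R))%:E <= minimax_risk eps X p0)%E.
Proof.
move=> p00 pp0; pose c (j : 'I_p0) (i : 'I_2) : 'I_p := widen_ord pp0 j.
have c_disj j j' i i' : c j i = c j' i' -> j = j'.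
  by move=> /(congr1 val) /= /val_inj.
apply: (@minimax_risk_block _ _ _ X sigma d Omega P eps sigma_gt0 Heps
  p0 2 c (fun _ i => (val i)%:R)) => //.
- by move=> _ [[|[|//]] ?] /=; rewrite ?expr0n ?expr1n.
- move=> f g; rewrite /block_vector -sumrB.
  under eq_bigr do rewrite -scalerBl.
  exact: norm0_sum_delta.
- move=> f g; have h_inj : injective (fun j => c j (f j)) by move=> j j' /c_disj.
  apply: le_trans (sum_sqr_le_norm2 _ h_inj).
  rewrite natr_sum; apply: ler_sum => j _; rewrite mxE [X in _ + X]mxE.
  rewrite !block_vector_entry// (_ : c j (f j) = c j (g j))// eqxx !mulr1.
  move: (f j) (g j) => [[|[|//]] ?] [[|[|//]] ?] //=;
  by rewrite ?subrr ?expr0n ?subr0 ?sub0r ?sqrrN ?expr1n.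
Qed.

End regimes.

(** This is [ln (1 + x) <= x] at [x = -1/2]. *)
Lemma ln2_ge_half (R : realType) : 1 / 2 <= ln 2%:R :> R.
Proof.
have := @le_ln1Dx R (- (1 / 2)); rewrite (_ : 1 - 1 / 2 = 2^-1); last by field.
rewrite lnV ?posrE//; lra.
Qed.

(** With [M >= 2] the integer quotient, [p < (M + 1) p0 <= M^2 p0], so [ln (p / p0) <= 2 ln M];
    moreover [1 <= 2 ln 2 <= 2 ln M]. *)
Lemma ln_divn_ge (R : realType) (p p0 : nat) : (0 < p0)%N -> (2 * p0 <= p)%N ->
  ln (p%:R / p0%:R) + 1 <= 4 * ln (p %/ p0)%:R :> R.
Proof.
move=> p00 pp0; set M := (p %/ p0)%N.
have M1 : (1 < M)%N by rewrite leq_divRL.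
have M0 : 0 < M%:R :> R by rewrite ltr0n ltnW.
have : ln (p%:R / p0%:R) <= ln (M%:R ^+ 2) :> R.
  rewrite ler_ln ?posrE ?exprn_gt0// ?divr_gt0 ?ltr0n//; last first.
    by rewrite (leq_trans _ pp0)// muln_gt0.
  rewrite ler_pdivrMr ?ltr0n// -natrX -natrM ler_nat ltnW//.
  apply: leq_trans (ltn_ceil p p00) _; rewrite leq_mul2r; apply/orP; right.
  rewrite -/M -mulnn; apply: (@leq_trans (2 * M)); last first.
    by rewrite leq_mul2r M1 orbT.
  by rewrite mul2n -addnn -add1n leq_add2r ltnW.
rewrite lnXn// -[ln _ *+ 2]mulr_natl.
have : ln 2%:R <= ln M%:R :> R by rewrite ler_ln ?posrE// ler_nat.
have := ln2_ge_half R; lra.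
Qed.

Theorem theorem4 (R : realType) :
  exists C2 : R, 0 < C2 /\
  forall (n p : nat) (X : 'M[R]_(n, p)) (sigma : R) (p0 : nat)
    (d : measure_display) (Omega : measurableType d) (P : probability Omega R)
    (eps : 'I_n -> {RV P >-> R}),
    any_rank_columns_independent X ->
    0 < sigma ->
    gaussian_noise eps sigma ->
    (1 <= p0 <= \rank X)%N ->
    ((2 * p0 <= \rank X)%N ->
       ((C2 * sigma ^+ 2 * tau X (2 * p0) *
          (p0%:R * (ln (p%:R / p0%:R) + 1)))%:E <=
        minimax_risk eps X p0)%E) /\
    ((\rank X <= 2 * p0)%N ->
       ((C2 * sigma ^+ 2 * tau X p0 * (\rank X)%:R)%:E <=
        minimax_risk eps X p0)%E).
Proof.
(* The factor 4 pays for replacing [ln (p / p0) + 1] by [ln M] in the sparse regime, and the rank by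
   [p0 ln 2] in the dense one. *)
exists (3 / 800 / 4); split; first by lra.
move=> n p X sigma p0 d Omega P eps _ sigma_gt0 Heps /andP[p00 p0r].
have rp : (\rank X <= p)%N := rank_leq_col X.
have p_gt0 : (0 < p)%N by exact: leq_trans p00 (leq_trans p0r rp).
have ratio_ge0 q : (0 < q)%N -> 0 <= phi_min X q / phi_max X q.
  move=> q0; apply: divr_ge0 (phi_min_ge0 _ _) _.
  by apply: le_trans (phi_max_ge X (Ordinal p_gt0) q0); exact: sqr_ge0.
split => [p0r2|rp0].
  rewrite /tau (minn_idPl p0r2).
  have pp0 := leq_trans p0r2 rp.
  apply: le_trans (minimax_risk_sparse X sigma_gt0 Heps p00 pp0).
  have := ln_divn_ge R p00 pp0; rewrite lee_fin.
  set l := ln _; set l' := ln _ => ll'.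
  rewrite (_ : 3 / 800 * _ * _ * _ = 3 / 800 / 4 * sigma ^+ 2 *
    (phi_min X (2 * p0) / phi_max X (2 * p0)) * (p0%:R * (4 * l'))).
    apply: ler_wpM2l; last exact: ler_wpM2l.
    apply: mulr_ge0; last by rewrite ratio_ge0// muln_gt0.
    by apply: mulr_ge0; [lra|exact: sqr_ge0].
  by move: (_ / phi_max X _) => ratio; field.
rewrite /tau (minn_idPl p0r).
apply: le_trans (minimax_risk_dense X sigma_gt0 Heps p00 (leq_trans p0r rp)).
rewrite lee_fin (_ : 3 / 800 * _ * _ * _ = 3 / 800 / 4 * sigma ^+ 2 *
    (phi_min X p0 / phi_max X p0) * (p0%:R * (4 * ln 2%:R))).
  apply: ler_wpM2l.
    apply: mulr_ge0 (ratio_ge0 _ p00).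
    by apply: mulr_ge0; [lra|exact: sqr_ge0].
  (* The rank is at most [2 * p0], and [2 <= 4 ln 2]. *)
  apply: (@le_trans _ _ (p0%:R * 2)).
    by rewrite -natrM ler_nat mulnC.
  by apply: ler_wpM2l => //; have := ln2_ge_half R; lra.
by move: (_ / phi_max X _) => ratio; field.
Qed.
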